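(* Let $n\ge2$ and let $T=(T_{kl})$ be a real symmetric $n\times n$-matrix with zeros on the diagonal. Let $t>0$ and let $m_1,\dots,m_n:[0,t]\to\{z\in\mathbb{C}:|z|=1\}$ be measurable functions such that $$\int_0^t m_k(t')\,\overline{m_l(t')}\,dt'=T_{kl}\qquad\text{for all }k\neq l .$$ Then $t\ge|\lambda_{\min}(T)|$, where $\lambda_{\min}(T)$ is the smallest eigenvalue of $T$. In other words, the time overhead for simulating the coupling $H_{\tilde C}$ by $H_C$, with $\tilde C$ the entry-wise product of $T$ and $C$, by schemes given by such functions is at least $|\lambda_{\min}(T)|$.
   Context: For a real symmetric $n\times n$-matrix $C=(c_{kl})$ with zero diagonal, $H_C=\sum_{k,l}c_{kl}\,a_ka_l^\dagger$ is the bilinear coupling of $n$ harmonic oscillators ($a_k$, $a_k^\dagger$ annihilation and creation operators of the $k$-th oscillator). A scheme of total duration $t$ is given by functions $m_k$ from $[0,t]$ to the complex numbers of modulus one: writing $m_k(t')=e^{i\theta_k(t')}$, at time $t'$ the evolution is conjugated by $\prod_k\exp(ih_k\theta_k(t'))$, where $h_k$ is the number operator $\mathrm{diag}(0,1,2,\dots,d-1)$ of the $k$-th oscillator. The scheme multiplies the coupling between oscillators $k$ and $l$ by $\int_0^t m_k\overline{m_l}\,dt'$; it simulates $H_{\tilde C}$ with time overhead $t$ when these numbers equal $T_{kl}$ for all $k\ne l$, where $\tilde c_{kl}=T_{kl}c_{kl}$. *)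

(* Defs.v *)
From HB Require Import structures.
From mathcomp Require Import all_boot all_order all_algebra.
From mathcomp Require Import complex polyrcf.
From mathcomp Require Import all_classical all_reals all_analysis.

Set Implicit Arguments.
Unset Strict Implicit.
Unset Printing Implicit Defensive.

Import Order.TTheory GRing.Theory Num.Theory.
Import numFieldNormedType.Exports.

Local Open Scope classical_set_scope.
Local Open Scope ring_scope.

(* R with the sigma-algebra of Lebesgue measurable sets. It contains the Borel
   sets, so Borel functions are covered. *)
Definition lebesgueR (R : realType) : measurableType _ :=
  caratheodory_type (mu_ext (@wlength R idfun)).

(* The library has no measurable structure or integral for R[i]-valued
   functions: both notions are taken componentwise. *)
Definition cmeasurable (R : realType) (D : set R) (f : R -> R[i]) : Prop :=
  measurable_fun (D : set (lebesgueR R))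
    ((fun s => complex.Re (f s)) : lebesgueR R -> R) /\
  measurable_fun (D : set (lebesgueR R))
    ((fun s => complex.Im (f s)) : lebesgueR R -> R).

Definition cintegral (R : realType) (D : set R) (f : R -> R[i]) : R[i] :=
  Complex (Rintegral (@completed_lebesgue_measure R) D (fun s => complex.Re (f s)))
          (Rintegral (@completed_lebesgue_measure R) D (fun s => complex.Im (f s))).

Definition phase_scheme (R : realType) (n : nat) (t : R)
    (m : 'I_n -> R -> R[i]) : Prop :=
  forall k, cmeasurable `[0, t] (m k) /\ {in `[0, t], forall s, `|m k s| = 1}.

Definition coupling_factor (R : realType) (n : nat) (t : R)
    (m : 'I_n -> R -> R[i]) (k l : 'I_n) : R[i] :=
  cintegral `[0, t] (fun s => m k s * conjc (m l s)).

(* Symmetric with zero diagonal: the matrices C defining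
   H_C = \sum_(k, l) c_kl a_k a_l^dagger. *)
Definition coupling_mx (R : realType) (n : nat) (C : 'M[R]_n) : Prop :=
  C^T = C /\ forall k, C k k = 0.

(* The scheme m of duration t simulates H_Ct by H_C, where Ct is the entrywise
   product of T and C. The factors are prescribed for all k != l, including
   those with C k l = 0. *)
Definition simulates (R : realType) (n : nat) (T C Ct : 'M[R]_n) (t : R)
    (m : 'I_n -> R -> R[i]) : Prop :=
  (forall k l, k != l -> coupling_factor t m k l = real_complex R (T k l)) /\
  (forall k l, Ct k l = T k l * C k l).

Definition simulation_overheads (R : realType) (n : nat) (T C Ct : 'M[R]_n) :
    set R :=
  [set t | 0 < t /\
    exists m : 'I_n -> R -> R[i], phase_scheme t m /\ simulates T C Ct t m].

(* The infimum is a minimum for symmetric matrices of positive size, see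
   lambda_minP below. *)
Definition lambda_min (R : realType) (n : nat) (A : 'M[R]_n) : R :=
  inf [set a | eigenvalue A a].

Lemma sym_eigenvalue_ex (R : realType) (n : nat) (A : 'M[R]_n) :
  (0 < n)%N -> A^T = A -> exists a, eigenvalue A a.
Proof.
move=> n0 symA.
have [mu] := @eigenvalue_closed R[i] n (map_mx (real_complex R) A) n0.
move=> emu; have /eigenvalueP[v vA v0] := emu.
pose w := map_mx (@conjc R) v^T.
have wA : map_mx (real_complex R) A *m w = conjc mu *: w.
  have /(congr1 (fun M => map_mx (@conjc R) M^T)) := vA.
  rewrite trmx_mul map_mxM linearZ /= map_mxZ => <-.
  congr (_ *m _); rewrite -{1}symA; apply/matrixP => i j.
  by rewrite !mxE conjc_real.
have vw : (v *m w) 0 0 != 0.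
  rewrite mxE psumr_eq0; last by move=> i _; rewrite !mxE mul_conjC_ge0.
  apply: contra v0 => /allP h; apply/eqP/rowP => i; rewrite mxE.
  have := h i (mem_index_enum i); rewrite !mxE mul_conjC_eq0.
  by move/eqP.
have : mu * (v *m w) 0 0 = conjc mu * (v *m w) 0 0.
  have -> : mu * (v *m w) 0 0 = (mu *: v *m w) 0 0 by rewrite -scalemxAl [RHS]mxE.
  rewrite -vA -mulmxA wA -scalemxAr mxE //.
move/(mulIf vw) => mureal.
have {}mureal : mu = real_complex R (complex.Re mu).
  case: mu mureal {emu vA wA vw} => a b /= [] /eqP.
  by rewrite -addr_eq0 -mulr2n mulrn_eq0 /= => /eqP ->.
by exists (complex.Re mu); rewrite -(eigenvalue_map (real_complex R)) /= -mureal.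
Qed.

Lemma lambda_minP (R : realType) (n : nat) (A : 'M[R]_n) :
  (0 < n)%N -> A^T = A ->
  eigenvalue A (lambda_min A) /\
  forall a, eigenvalue A a -> lambda_min A <= a.
Proof.
move=> n0 symA.
have p0 : char_poly A != 0 by rewrite monic_neq0 ?char_poly_monic.
have rE a : (a \in rootsR (char_poly A)) = eigenvalue A a.
  rewrite eigenvalue_root_char; have := roots_on_rootsR p0 a.
  by rewrite in_itv /= => <-.
have [a0 ea0] := sym_eigenvalue_ex n0 symA.
have [b eb bmin] : exists2 b, eigenvalue A b &
    forall a, eigenvalue A a -> b <= a.
  have sE a : (a \in sort <=%R (rootsR (char_poly A))) = eigenvalue A a.
    by rewrite mem_sort rE.
  have := sort_le_sorted (rootsR (char_poly A)).
  case: sort sE => [|b s] sE srt; first by move: ea0; rewrite -sE.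
  exists b; first by rewrite -sE mem_head.
  move=> a; rewrite -sE inE => /predU1P[->//|as_].
  by have /allP := order_path_min le_trans srt; apply.
have -> : lambda_min A = b.
  apply/eqP; rewrite eq_le; apply/andP; split.
    by apply: ge_inf => //; exists b => a /bmin.
  by apply: lb_le_inf; [exists b | move=> a /bmin].
by split.
Qed.

(* Main.v *)
(** The matrix G_kl = \int_0^t m_k (m_l)^* is a Gram matrix, hence positive
    semidefinite. Its diagonal entries are t because |m_k| = 1, so G = T + t I.
    Testing G on an eigenvector of T for lambda_min(T) gives
    t + lambda_min(T) >= 0. Moreover lambda_min(T) <= 0, since n lambda_min(T)
    is at most the trace of T, which vanishes. *)

Require Import Defs.
From mathcomp Require Import all_boot all_order all_algebra.
From mathcomp Require Import complex.
From mathcomp Require Import all_classical all_reals all_analysis.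
From mathcomp Require Import measurable_realfun.
From mathcomp Require Import ring.

Set Implicit Arguments.
Unset Strict Implicit.
Unset Printing Implicit Defensive.

Import Order.TTheory GRing.Theory Num.Theory.
Import numFieldNormedType.Exports.

Local Open Scope classical_set_scope.
Local Open Scope ring_scope.

(** Over [R[i]] the matrix becomes Hermitian, and the spectral theorem writes its trace as a sum of
    [n] real eigenvalues, each of them an eigenvalue of [A] over [R]. For trace zero this yields
    [lambda_min A <= 0] as soon as [n] is positive. *)
Lemma lambda_min_trace (R : realType) (n : nat) (A : 'M[R]_n) :
  A^T = A -> lambda_min A *+ n <= \tr A.
Proof.
case: n A => [|n] A symA; first by rewrite mulr0n /mxtrace big_ord0.
have [_ lamP] := lambda_minP (ltn0Sn n) symA.
pose AC := map_mx (real_complex R) A.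
have hermA : AC \is hermsymmx.
  apply/is_hermitianmxP; rewrite expr0 scale1r; apply/matrixP => i j.
  by rewrite !mxE -[in RHS]symA mxE; apply/esym/conjc_real.
have diag_real := hermitian_spectral_diag_real hermA.
have /orthomx_spectralP := hermitian_normalmx hermA.
set P := spectralmx AC; set d := spectral_diag AC => AE.
have Pu : P \in unitmx by exact: spectral_unit.
have tr_d : real_complex R (\tr A) = \sum_i d 0 i.
  by rewrite -trace_map_mx -/AC AE -mulmxA mxtrace_mulC mulmxK// mxtrace_diag.
have d_ge i : real_complex R (lambda_min A) <= d 0 i.
  have : eigenvalue AC (d 0 i).
    (* From [AC = P^-1 diag(d) P], row [i] of [P] is a left eigenvector for [d 0 i]; it is nonzero
       because [P] is invertible. *)
    apply/eigenvalueP; exists (row i P); last first.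
      apply/eqP => /(congr1 (mulmx^~ (invmx P))).
      rewrite -row_mul mulmxV// row1 mul0mx => /rowP/(_ i)/eqP.
      by rewrite !mxE !eqxx oner_eq0.
    rewrite {1}AE -row_mul !mulmxA mulmxV// mul1mx row_mul.
    by rewrite row_diag_mx -scalemxAl -rowE.
  have /mxOverP/(_ 0 i)/complex_realP[x dx] := diag_real.
  rewrite -/d in dx; rewrite dx eigenvalue_map => /lamP.
  by rewrite lecR.
rewrite -lecR tr_d rmorphMn /=.
have -> : real_complex R (lambda_min A) *+ n.+1 =
    \sum_(i < n.+1) real_complex R (lambda_min A).
  by rewrite sumr_const card_ord.
exact: ler_sum.
Qed.

Lemma RintegralZ_sum d (T : measurableType d) (R : realType)
    (mu : {measure set T -> \bar R}) (D : set T) (I : finType)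
    (c : I -> R) (f : I -> T -> R) :
  measurable D -> (forall i, mu.-integrable D (EFin \o f i)) ->
  Rintegral mu D (fun x => \sum_i c i * f i x) =
  \sum_i c i * Rintegral mu D (f i).
Proof.
move=> mD intf.
have intcf i : mu.-integrable D (EFin \o (fun x => c i * f i x)).
  exact: (integrableZl mD (c i) (intf i)).
elim: (index_enum I) => [|i s IH].
  rewrite big_nil.
  under eq_Rintegral do rewrite big_nil.
  by rewrite Rintegral_cst// mul0r.
rewrite big_cons -IH -(RintegralZl _ mD)// -RintegralD//.
  by under eq_Rintegral do rewrite big_cons.
rewrite (_ : EFin \o _ =
  fun x => (\sum_(j <- s) (c j * f j x)%:E)%E).
  exact: (integrable_sum mD s (fun j _ => intcf j)).
by apply/funext => x /=; rewrite sumEFin.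
Qed.

(** For real [v] the form is the integral of the squared modulus of [\sum_k v k * m k]. Real parts
    suffice: the imaginary part of [m_k (m_l)^*] is antisymmetric in [k], [l] and cancels. *)
Lemma gram_ge0 d (T : measurableType d) (R : realType)
    (mu : {measure set T -> \bar R}) (D : set T) (I : finType)
    (v : I -> R) (m : I -> T -> R[i]) :
  measurable D ->
  (forall k l, mu.-integrable D
     (EFin \o (fun s => complex.Re (m k s * conjc (m l s))))) ->
  0 <= \sum_k \sum_l
    v k * v l * Rintegral mu D (fun s => complex.Re (m k s * conjc (m l s))).
Proof.
move=> mD intm.
rewrite pair_bigA /= -(RintegralZ_sum _ mD) //.
apply: Rintegral_ge0 => s _.
rewrite -(pair_bigA _
  (fun k l => v k * v l * complex.Re (m k s * conjc (m l s)))) /=.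
have -> : \sum_k \sum_l v k * v l * complex.Re (m k s * conjc (m l s)) =
    (\sum_k v k * complex.Re (m k s)) ^+ 2 +
    (\sum_k v k * complex.Im (m k s)) ^+ 2.
  rewrite !expr2 !mulr_suml -big_split /=; apply: eq_bigr => k _.
  rewrite !mulr_sumr -big_split /=; apply: eq_bigr => l _.
  by case: (m k s) (m l s) => [a b] [a' b'] /=; ring.
by rewrite addr_ge0 ?sqr_ge0.
Qed.

Lemma completed_lebesgue_measure_itv0 (R : realType) (t : R) : 0 <= t ->
  completed_lebesgue_measure (`[0, t] : set (lebesgueR R)) = t%:E.
Proof.
move=> t0.
have := @lebesgue_measure_itv R `[0, t].
(* Both Lebesgue measures restrict the same outer measure, so [E] applies to the completed one by
   conversion. *)
rewrite /= lte_fin sube0 => E; transitivity (if 0 < t then t%:E else 0%E) => //.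
by case: ltgtP t0 => // <-.
Qed.

Lemma measurable_lebesgueR (R : realType) (A : set R) :
  measurable A -> measurable (A : set (lebesgueR R)).
Proof. by move=> mA; apply: sub_caratheodory. Qed.

(** The integrand is measurable and bounded by 1 on a set of finite measure. *)
Lemma phase_scheme_integrable (R : realType) (n : nat) (t : R)
    (m : 'I_n -> R -> R[i]) (k l : 'I_n) : 0 <= t -> phase_scheme t m ->
  (@completed_lebesgue_measure R).-integrable `[0, t]
    (EFin \o (fun s => complex.Re (m k s * conjc (m l s)))).
Proof.
move=> t0 mP; have [[mReK mImK] nK] := mP k; have [[mReL mImL] nL] := mP l.
apply: measurable_bounded_integrable.
- exact: measurable_lebesgueR (measurable_itv _).
- by rewrite [ltLHS](completed_lebesgue_measure_itv0 t0) ltry.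
- have -> : (fun s => complex.Re (m k s * conjc (m l s))) =
      (fun s => complex.Re (m k s) * complex.Re (m l s) +
                complex.Im (m k s) * complex.Im (m l s)).
    by apply/funext => s; case: (m k s) (m l s) => [a b] [a' b'] /=; ring.
  by apply: measurable_funD => //; apply: measurable_funM.
- exists 1; split => // M M1 s /= st.
  apply: le_trans (ltW M1); rewrite -lecR.
  apply: le_trans (normc_ge_Re _) _.
  by rewrite normrM normcJ nK ?nL ?mulr1// inE.
Qed.

(** Unit modulus makes the integrand constantly 1. This supplies the diagonal of the Gram matrix,
    about which the conditions for [k != l] say nothing. *)
Lemma phase_scheme_diag (R : realType) (n : nat) (t : R)
    (m : 'I_n -> R -> R[i]) (k : 'I_n) : 0 <= t -> phase_scheme t m ->
  coupling_factor t m k k = real_complex R t.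
Proof.
move=> t0 mP; have [_ nK] := mP k.
have mm s : s \in `[0, t] -> m k s * conjc (m k s) = 1.
  by move=> st; rewrite -[LHS]normCK nK// expr1n.
have mD := measurable_lebesgueR (measurable_itv `[0, t]).
have -> : coupling_factor t m k k = cintegral `[0, t] (fun=> 1).
  by congr Complex; apply: eq_Rintegral => s; rewrite inE => /= st; rewrite mm.
rewrite /cintegral !Rintegral_cst//= completed_lebesgue_measure_itv0//.
by rewrite mul1r mul0r.
Qed.

Theorem mainTheorem8 (R : realType) (n : nat) (hn : (2 <= n)%N)
    (T : 'M[R]_n) (symT : T^T = T) (diagT : forall k, T k k = 0) :
  (forall (t : R) (m : 'I_n -> R -> R[i]), 0 < t -> phase_scheme t m ->
     (forall k l : 'I_n, k != l ->
        cintegral `[0, t] (fun s => m k s * conjc (m l s)) =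
        real_complex R (T k l)) ->
     `|lambda_min T| <= t) /\
  (forall C Ct : 'M[R]_n, coupling_mx C -> (forall k l, Ct k l = T k l * C k l) ->
     lbound (simulation_overheads T C Ct) `|lambda_min T|).
Proof.
have n0 : (0 < n)%N by apply: ltn_trans hn.
have bound (t : R) (m : 'I_n -> R -> R[i]) : 0 < t -> phase_scheme t m ->
    (forall k l : 'I_n, k != l ->
      coupling_factor t m k l = real_complex R (T k l)) ->
    `|lambda_min T| <= t.
  move=> t0 mP mT.
  have [/eigenvalueP[v vT v0] _] := lambda_minP n0 symT.
  have lam0 : lambda_min T <= 0.
    have := lambda_min_trace symT.
    by rewrite /mxtrace big1// pmulrn_lle0.
  rewrite ler0_norm// -subr_ge0 opprK.
  have GE k l : Rintegral (@completed_lebesgue_measure R) `[0, t]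
      (fun s => complex.Re (m k s * conjc (m l s))) = T k l + t *+ (k == l).
    rewrite -[LHS]/(complex.Re (coupling_factor t m k l)).
    have [<-|kl] := eqVneq k l; last by rewrite mT// addr0.
    by rewrite phase_scheme_diag ?ltW// diagT add0r.
  have mD := measurable_lebesgueR (measurable_itv `[0, t]).
  have := gram_ge0 (fun k => v 0 k) mD
    (fun k l => phase_scheme_integrable k l (ltW t0) mP).
  have -> : \sum_k \sum_l v 0 k * v 0 l *
      Rintegral (@completed_lebesgue_measure R) `[0, t]
        (fun s => complex.Re (m k s * conjc (m l s))) =
      (t + lambda_min T) * \sum_l v 0 l ^+ 2.
    (* As [v] is a row eigenvector, summing over [k] first exposes entry [l] of [v *m T], which is
       [lambda_min T * v 0 l]. *)
    rewrite exchange_big mulr_sumr; apply: eq_bigr => l _ /=.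
    under eq_bigr do rewrite GE mulrDr.
    rewrite big_split /= [X in _ + X](bigD1 l)//= eqxx.
    rewrite [X in _ + (_ + X)]big1; last first.
      by move=> k /negPf kl; rewrite kl mulr0.
    rewrite addr0 mulr1n.
    have /rowP/(_ l) := vT; rewrite !mxE => vTl.
    transitivity (v 0 l * \sum_k v 0 k * T k l + t * v 0 l ^+ 2).
      rewrite mulr_sumr; congr +%R; last by ring.
      by apply: eq_bigr => k _; ring.
    by rewrite vTl; ring.
  (* The factor [\sum_l v 0 l ^+ 2] may be cancelled because it is positive: a vanishing sum of
     squares would force [v = 0]. *)
  rewrite pmulr_lge0// lt_def sumr_ge0 ?andbT; last by move=> *; exact: sqr_ge0.
  apply: contra v0; rewrite psumr_eq0; last by move=> *; exact: sqr_ge0.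
  move=> /allP v0; apply/eqP/rowP => l; rewrite mxE.
  by have := v0 l (mem_index_enum _); rewrite /= sqrf_eq0 => /eqP.
(* The integral in the first claim is [coupling_factor] unfolded, so [bound] settles both claims. *)
split=> [t m t0 mP mT|C Ct _ _ t [t0 [m [mP [mT _]]]]]; exact: bound mP mT.
Qed.
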